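(* Let $p$ be a prime and let $V$ be an infinite-dimensional Hausdorff topological vector space over the field $\mathbb F_p$. Then $V$ has an infinite-dimensional vector subspace $W$ and $W$ has a basis $E$ (as a vector space over $\mathbb F_p$) such that the topology on $W$ induced from $V$ is finer than or equal to the product topology on $W$ associated with $E$; therefore, for every $e\in E$, the projection $\pi_e\colon W=\bigoplus_{e'\in E}\langle e'\rangle\to\langle e\rangle$ onto the one-dimensional subspace $\langle e\rangle$ is continuous with respect to the topology on $W$ induced from $V$.
   Context: The field $\mathbb F_p$ carries the discrete topology. For a vector space $W$ over $\mathbb F_p$ with basis $E$, one has $W=\bigoplus_{e\in E}\langle e\rangle$, where $\langle e\rangle$ is the one-dimensional subspace (cyclic group of order $p$) generated by $e$. The product topology on $W$ associated with $E$ is the topology induced on $W=\bigoplus_{e\in E}\langle e\rangle\subset\prod_{e\in E}\langle e\rangle$ by the Tychonoff product topology, where each finite group $\langle e\rangle$ is discrete. The projection $\pi_e$ sends an element of $W$ to its $e$-component in this direct sum decomposition. *)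

(* Defs.v *)
From HB Require Import structures.
From mathcomp Require Import all_boot all_order all_algebra.
From mathcomp Require Import all_classical reals topology.

Set Implicit Arguments.
Unset Strict Implicit.
Unset Printing Implicit Defensive.
Import GRing.Theory.
Local Open Scope classical_set_scope.
Local Open Scope ring_scope.

(* A topological vector space over a field K carrying the discrete topology.
   The library's [topologicalLmodType] requires an ordered, normed ring of
   scalars, hence excludes finite fields; its file [tvs] must not be loaded
   before this declaration, since its join of [Nbhs] and [Lmodule] over a
   [numDomainType] would clash with ours over a [fieldType].  Continuity of the
   opposite is the continuity of the scaling by -1. *)
HB.mixin Record Topological_isDiscTVS (K : fieldType) M
    & Topological M & GRing.Lmodule K M := {
  disc_add_continuous : continuous (fun z : M * M => z.1 + z.2) ;
  disc_scale_continuous :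
    continuous (fun z : discrete_topology K * M => (z.1 : K) *: z.2)
}.

#[short(type="discTvsType")]
HB.structure Definition DiscTVS (K : fieldType) :=
  {M of Topological M & GRing.Lmodule K M & Topological_isDiscTVS K M}.

Section LinearAlgebra.
Context {K : fieldType} {V : lmodType K}.
Implicit Types (E W : set V).

Definition subvector_space W := submod_closed [in W].

Definition lin_span E : set V :=
  [set v | exists (s : seq V) (c : V -> K),
     [set` s] `<=` E /\ v = \sum_(x <- s) c x *: x].

Definition lin_independent E :=
  forall (s : seq V) (c : V -> K), uniq s -> [set` s] `<=` E ->
    \sum_(x <- s) c x *: x = 0 -> forall x, x \in s -> c x = 0.

Definition is_basis W E := lin_independent E /\ lin_span E = W.

Definition infinite_dimensional W :=
  ~ exists2 E, finite_set E & is_basis W E.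

(* The subspace <e>. *)
Definition line (e : V) : set V := [set a *: e | a in [set: K]].

Lemma line_has0 e : 0 \in line e.
Proof. by apply/mem_set; exists 0 => //; rewrite scale0r. Qed.

Definition line0 e : line e := exist _ 0 (line_has0 e).

Definition is_decomposition E (v : V) (c : forall e : E, line (set_val e)) :=
  finite_set [set e : E | set_val (c e) != 0] /\
  v = \sum_(e \in [set: E]) set_val (c e).

(* The image of v under (+)_(e in E) <e> -> prod_(e in E) <e>.  When E is a
   basis of W and v is in W, the decomposition exists and is unique
   ([componentsP], [decomposition_unique] below); otherwise the value is junk. *)
Definition components E (v : V) : forall e : E, line (set_val e) :=
  xget (fun e : E => line0 (set_val e)) [set c | is_decomposition v c].

Let sum_over_basis E (s : seq V) (g : V -> V) :
    uniq s -> [set` s] `<=` E -> (forall x, E x -> x \notin s -> g x = 0) ->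
  \sum_(e \in [set: E]) g (set_val e) = \sum_(x <- s) g x.
Proof.
move=> us sE g0.
have bij : set_bij [set: E] E (set_val : E -> V).
  split=> [e _|e f _ _ ef|x Ex]; first exact: set_valP.
    exact/val_inj.
  by exists (exist _ x (mem_set Ex)).
rewrite -(reindex_fsbig _ _ _ _ bij) [RHS]fsbig_seq//.
by apply/esym/fsbig_widen => // x [Ex /negP xs]; exact: g0.
Qed.

Lemma decomposition_exists E v :
  lin_span E v -> exists c : forall e : E, line (set_val e), is_decomposition v c.
Proof.
move=> [s [c [sE vE]]].
pose g x := (c x *+ count_mem x s) *: x.
have gl x : g x \in line x by apply/mem_set; exists (c x *+ count_mem x s).
have g0 x : x \notin s -> g x = 0.
  by move=> /count_memPn xs; rewrite /g xs mulr0n scale0r.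
exists (fun e => exist _ (g (set_val e)) (gl _)); split.
  apply: (@sub_finite_set _ _ (set_val @^-1` [set` s])).
    by move=> e /=; apply: contra_neqP => /negP; exact: g0.
  apply: finite_preimage => // e f _ _; exact: val_inj.
rewrite (@sum_over_basis _ (undup s) g) ?undup_uniq//.
- rewrite vE -[LHS]big_undup_iterop_count; apply: eq_bigr => x _.
  by rewrite /g -scalerMnl.
- by move=> x /=; rewrite mem_undup; exact: sE.
- by move=> x _; rewrite mem_undup; exact: g0.
Qed.

Lemma decomposition_unique E v (c d : forall e : E, line (set_val e)) :
  lin_independent E -> is_decomposition v c -> is_decomposition v d -> c = d.
Proof.
have coef (h : forall e : E, line (set_val e)) :
    exists a : V -> K, forall e : E, set_val (h e) = a (set_val e) *: set_val e.
  suff /choice[a aP] x : exists b, forall e : E, set_val e = x ->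
      set_val (h e) = b *: x by exists a => e; exact: aP.
  have [Ex|nEx] := pselect (E x); last first.
    by exists 0 => e ex; case: nEx; rewrite -ex; exact: set_valP.
  have [b _ bP] := set_valP (h (exist _ x (mem_set Ex))).
  exists b => e ex; have -> : e = exist _ x (mem_set Ex) by exact/val_inj.
  exact/esym.
move=> indep [fc vc] [fd vd].
have [a aP] := coef c; have [b bP] := coef d.
have /finite_seqP[s sE] := (finite_image set_val fc).
have /finite_seqP[t tE] := (finite_image set_val fd).
pose r := undup (s ++ t).
have rE : [set` r] `<=` E.
  move=> x /=; rewrite mem_undup mem_cat => /orP[xs|xt].
    have : [set` s] x by [].
    by rewrite -sE => -[e _ <-]; exact: set_valP.
  have : [set` t] x by [].
  by rewrite -tE => -[e _ <-]; exact: set_valP.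
have key (h : forall e : E, line (set_val e)) f :
    (forall e : E, set_val (h e) = f (set_val e) *: set_val e) ->
    (forall e : E, set_val (h e) != 0 -> set_val e \in r) ->
    \sum_(e \in [set: E]) set_val (h e) = \sum_(x <- r) f x *: x.
  move=> fP hr; rewrite -(@sum_over_basis E r (fun x => f x *: x)) ?undup_uniq//.
    by apply: eq_fsbigr => e _; exact: fP.
  move=> x Ex xr; have := fP (exist _ x (mem_set Ex)).
  by move=> <-; apply: contraNeq xr => /hr.
have cr e : set_val (c e) != 0 -> set_val e \in r.
  move=> ce; rewrite mem_undup mem_cat; apply/orP; left.
  by suff : [set` s] (set_val e) by []; rewrite -sE; exists e.
have dr e : set_val (d e) != 0 -> set_val e \in r.
  move=> ce; rewrite mem_undup mem_cat; apply/orP; right.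
  by suff : [set` t] (set_val e) by []; rewrite -tE; exists e.
have ab : forall x, x \in r -> a x - b x = 0.
  apply: indep (undup_uniq _) rE _.
  under eq_bigr do rewrite scalerBl.
  by rewrite sumrB -(key _ _ aP cr) -(key _ _ bP dr) -vc -vd subrr.
apply/functional_extensionality_dep => e; apply/val_inj.
change (set_val (c e) = set_val (d e)).
have [er|er] := boolP (set_val e \in r).
  by rewrite aP bP; congr (_ *: _); apply/eqP; rewrite -subr_eq0 ab.
have /eqP -> : set_val (c e) == 0 by apply: contraNT er => /cr.
by apply/esym/eqP; apply: contraNT er => /dr.
Qed.

Lemma componentsP W E v : is_basis W E -> W v ->
  is_decomposition v (@components E v).
Proof.
move=> [_ <-] /decomposition_exists vE.
exact: (@xgetPex _ _ [set c | is_decomposition v c]).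
Qed.

Definition proj_line W E (e : E) (w : W) : line (set_val e) :=
  @components E (set_val w) e.

End LinearAlgebra.

Arguments components {K V} E v.
Arguments proj_line {K V} W {E} e w.

Section ProductTopology.
Context {K : fieldType} {V : lmodType K}.

Definition lines_prod (E : set V) :=
  prod_topology (fun e : E => discrete_topology (line (set_val e))).

Definition to_lines_prod (W E : set V) (w : W) : lines_prod E :=
  components E (set_val w).

(* The topology induced on W by the Tychonoff topology on prod_(e in E) <e>. *)
Definition basis_topology (W E : set V) :=
  initial_topology (@to_lines_prod W E).

End ProductTopology.

(* Main.v *)
(* If {0} is open, any infinite independent sequence spans a suitable W.
   Otherwise choose alternately vectors e_n and neighbourhoods N_n of 0: N_n is
   so small that (N_n - N_n) meets the finite space <e_j | j < n> only in 0,
   while e_n lies in M_n and N_(n+1) is included in M_n, for a neighbourhood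
   M_n of 0 with K M_n + M_n included in N_n.  Then every tail combination of
   the e_j, j >= n, lies in N_n, so that a combination of the e_j lying in N_n
   has zero coefficients below n.  Hence all coordinates are continuous on the
   span of the e_n. *)
Require Import Defs.
From mathcomp Require Import all_boot all_order all_algebra.
From mathcomp Require Import all_classical reals topology.

Set Implicit Arguments.
Unset Strict Implicit.
Unset Printing Implicit Defensive.
Import GRing.Theory.
Local Open Scope classical_set_scope.
Local Open Scope ring_scope.

(** * Linear algebra: finite spans over a finite field *)

Lemma sum_count_mem (I : eqType) (V : nmodType) (r s : seq I) (f : I -> V) :
    uniq r -> {subset s <= r} ->
  \sum_(x <- s) f x = \sum_(x <- r) f x *+ count_mem x s.
Proof.
move=> ur; elim: s => [_|y s IHs sr]; first by rewrite big_nil big1.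
rewrite big_cons IHs; last by move=> x xs; apply: sr; rewrite inE xs orbT.
have yr : y \in r by apply: sr; rewrite mem_head.
rewrite (bigD1_seq y)//= [RHS](bigD1_seq y)//= eqxx add1n mulrS addrA.
by congr (_ + _); apply: eq_bigr => x /negPf xy; rewrite eq_sym xy.
Qed.

Section FiniteSpans.
Context {K : finFieldType} {V : lmodType K}.
Implicit Types (s t : seq V) (u v x : V).

(** Since [K] is finite, the span of [t] can be listed as a finite sequence; this finiteness is what
    lets a neighbourhood of 0 avoid its nonzero elements. *)
Fixpoint combos t : seq V :=
  if t is x :: t' then [seq c *: x + v | c <- enum K, v <- combos t'] else [:: 0].

Lemma mem_combos_cons x t v :
  reflect (exists c, exists2 u, u \in combos t & v = c *: x + u)
    (v \in combos (x :: t)).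
Proof.
apply: (iffP allpairsP) => [[[c u] /= [_ ut ->]]|[c [u ut ->]]].
  by exists c, u.
by exists (c, u); split; rewrite ?mem_enum.
Qed.

Lemma combos0 t : 0 \in combos t.
Proof.
elim: t => [|x t IHt]; first by rewrite mem_head.
by apply/mem_combos_cons; exists 0, 0; rewrite // scale0r addr0.
Qed.

Lemma combos_linear t a u v :
  u \in combos t -> v \in combos t -> a *: u + v \in combos t.
Proof.
elim: t u v => [|x t IHt] u v.
  by rewrite !inE => /eqP-> /eqP->; rewrite scaler0 addr0.
move=> /mem_combos_cons[c [u' u't ->]] /mem_combos_cons[d [v' v't ->]].
apply/mem_combos_cons; exists (a * c + d), (a *: u' + v'); first exact: IHt.
by rewrite scalerDr scalerA scalerDl addrACA.
Qed.

Lemma mem_combos t x : x \in t -> x \in combos t.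
Proof.
elim: t => // y t IHt; rewrite inE => /orP[/eqP->|/IHt xt].
  by apply/mem_combos_cons; exists 1, 0; rewrite ?combos0// scale1r addr0.
by apply/mem_combos_cons; exists 0, x; rewrite // scale0r add0r.
Qed.

Lemma lin_span_combos t v : lin_span [set` t] v -> v \in combos t.
Proof.
move=> [s [c [st ->]]].
elim: s st => [|x s IHs] st; rewrite ?big_nil ?big_cons; first exact: combos0.
apply: combos_linear; first by apply/mem_combos/st; rewrite /= mem_head.
by apply: IHs => y ys; apply: st; rewrite /= inE ys orbT.
Qed.

(** Triangular form of independence: a new vector is put at the head and need only avoid the span of
    the old ones. *)
Fixpoint lin_free t : bool :=
  if t is x :: t' then (x \notin combos t') && lin_free t' else true.

Lemma lin_free_eq0 x t c v :
  x \notin combos t -> v \in combos t -> c *: x + v = 0 -> c = 0.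
Proof.
move=> xt vt /eqP; rewrite addr_eq0 => /eqP cx; apply/eqP.
apply: contraNT xt => c0.
rewrite -(scalerK c0 x) cx scalerN -scaleNr -[_ *: _]addr0.
exact/combos_linear/combos0.
Qed.

Lemma combos_sum t v : lin_free t -> v \in combos t ->
  exists c : V -> K, v = \sum_(x <- t) c x *: x.
Proof.
elim: t v => [|x t IHt] v /=.
  by rewrite inE => _ /eqP ->; exists (fun=> 0); rewrite big_nil.
move=> /andP[xt tfree] /mem_combos_cons[a [u ut ->]].
have [c ->] := IHt _ tfree ut.
(* Coefficients are indexed by vectors, so changing the value at [x] is harmless only because [x]
   does not recur in [t]. *)
exists (fun y => if y == x then a else c y).
rewrite big_cons eqxx; congr (_ + _); apply: eq_big_seq => y yt.
case: eqP yt => // -> xt'; by rewrite mem_combos in xt.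
Qed.

Lemma sum_mem_combos t (c : V -> K) : \sum_(x <- t) c x *: x \in combos t.
Proof. by apply: lin_span_combos; exists t, c; split=> // x. Qed.

Lemma lin_free_uniq t : lin_free t -> uniq t.
Proof.
elim: t => //= x t IHt /andP[xt /IHt ->]; rewrite andbT.
by apply: contra xt; exact: mem_combos.
Qed.

Lemma lin_free_coef t (c : V -> K) : lin_free t ->
  \sum_(x <- t) c x *: x = 0 -> forall x, x \in t -> c x = 0.
Proof.
elim: t => //= x t IHt /andP[xt tfree]; rewrite big_cons => s0 y.
have cx := lin_free_eq0 xt (sum_mem_combos t c) s0.
rewrite inE => /orP[/eqP->//|]; apply: IHt => //.
by move: s0; rewrite cx scale0r add0r.
Qed.

Lemma lin_free_indep t : lin_free t -> lin_independent [set` t].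
Proof.
(* Weighting by [count_mem] extends the coefficients by zero from [s] to all of [t]. *)
move=> tfree s c us st; rewrite (sum_count_mem _ (lin_free_uniq tfree) st).
under eq_bigr do rewrite scalerMnl.
move=> /(lin_free_coef tfree) c0 x xs.
by have := c0 _ (st _ xs); rewrite count_uniq_mem// xs.
Qed.

(** Otherwise [t] would be a finite basis of [V]. *)
Lemma lin_free_extend t : infinite_dimensional [set: V] -> lin_free t ->
  exists x, x \notin combos t.
Proof.
move=> Vinf tfree; apply: contrapT => nx; apply: Vinf.
exists [set` t] => //; split; first exact: lin_free_indep.
apply/seteqP; split=> // v _; have vt : v \in combos t.
  by apply/negPn/negP => vt; apply: nx; exists v.
by have [c ->] := combos_sum tfree vt; exists t, c; split=> // x.
Qed.

(** A finite basis would make [W] a finite set, with no room for infinitely many values of [e]. *)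
Lemma infinite_dimensional_injective (W : set V) (e : nat -> V) :
  injective e -> (forall n, W (e n)) -> infinite_dimensional W.
Proof.
move=> einj We [E /finite_seqP[t ->] [_ spanE]].
pose r := [seq e i | i <- iota 0 (size (combos t)).+1].
have : (size r <= size (combos t))%N.
  apply: uniq_leq_size; first by rewrite map_inj_uniq ?iota_uniq.
  by move=> _ /mapP[i _ ->]; apply: lin_span_combos; rewrite spanE.
by rewrite size_map size_iota ltnn.
Qed.

End FiniteSpans.

Section Spans.
Context {K : fieldType} {V : lmodType K}.

Lemma subvector_space_lin_span (E : set V) : subvector_space (lin_span E).
Proof.
split; first by apply/mem_set; exists [::], (fun=> 0); rewrite big_nil.
move=> a u v /set_mem[s [c [sE ->]]] /set_mem[t [d [tE ->]]]; apply/mem_set.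
pose r := undup (s ++ t); have ur : uniq r := undup_uniq _.
have sr : {subset s <= r} by move=> x xs; rewrite mem_undup mem_cat xs.
have tr : {subset t <= r} by move=> x xt; rewrite mem_undup mem_cat xt orbT.
(* The two lists may repeat vectors; their multiplicities are absorbed into the coefficients over
   the duplicate-free union [r]. *)
exists r, (fun x => a * c x *+ count_mem x s + d x *+ count_mem x t); split.
  by move=> x /=; rewrite mem_undup mem_cat => /orP[/sE|/tE].
rewrite scaler_sumr (sum_count_mem _ ur sr) (sum_count_mem _ ur tr) -big_split/=.
by apply: eq_bigr => x _; rewrite scalerDl -!scalerMnl scalerA.
Qed.

End Spans.

(** * Neighbourhoods of zero *)

Section BasicSequence.
Context {K : finFieldType} {V : discTvsType K}.
Implicit Types (N : set V) (e : nat -> V).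

Lemma scale_continuous (a : K) : continuous (fun x : V => a *: x).
Proof.
move=> x N /(@disc_scale_continuous K V (a, x))[[A B] /= [Aa Bx] sub].
by apply: filterS Bx => y By; apply: (sub (a, y)); split=> //;
  exact: nbhs_singleton Aa.
Qed.

Lemma addl_continuous (v : V) : continuous (fun x : V => x + v).
Proof.
move=> x N /(@disc_add_continuous K V (x, v))[[A B] /= [Ax Bv] sub].
by apply: filterS Ax => y Ay; apply: (sub (y, v)); split=> //;
  exact: nbhs_singleton Bv.
Qed.

(** Each scalar gives one neighbourhood of (0, 0) by continuity; finiteness of [K] allows
    intersecting them all. *)
Lemma nbhs0_linear N : nbhs (0 : V) N ->
  exists2 M, nbhs (0 : V) M &
    forall (a : K) x y, M x -> M y -> N (a *: x + y).
Proof.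
move=> N0.
have NA : nbhs (0 : V, 0 : V) [set z | forall a : K, N (a *: z.1 + z.2)].
  pose f (a : K) := [set z : V * V | N (a *: z.1 + z.2)].
  apply: (@filter_forall _ K f (nbhs (0 : V, 0 : V))) => a.
  have [[A B] /= [A0 B0] sub] :
      nbhs (a *: (0 : V), 0 : V) [set z | N (z.1 + z.2)].
    apply: (@disc_add_continuous K V (a *: 0, 0)).
    by rewrite /= scaler0 addr0.
  exists ((fun x : V => a *: x) @^-1` A, B).
    by split=> //=; exact: scale_continuous A0.
  by move=> [x y] [/= Ax By]; exact: (sub (a *: x, y)).
case: NA => -[A B] /= [A0 B0] sub.
exists (A `&` B); first exact: filterI.
by move=> a x y [Ax _] [_ By]; exact: (sub (x, y)).
Qed.

(** Finite sets are closed in a Hausdorff space, so removing the nonzero elements of [s] leaves a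
    neighbourhood of 0, and differences can be kept inside it. *)
Lemma nbhs0_separated (s : seq V) : hausdorff_space V ->
  exists2 N, nbhs (0 : V) N & forall x y, N x -> N y -> y - x \in s -> x = y.
Proof.
move=> V_haus.
have oC : nbhs (0 : V) (~` ([set` s] `\` [set 0])).
  apply: open_nbhs_nbhs; split; last by case=> _; apply.
  apply: closed_openC; move: (hausdorff_accessible V_haus).
  by rewrite accessible_finite_set_closed; apply; exact/finite_setD/finite_seq.
have [N N0 lin] := nbhs0_linear oC.
exists N => // x y Nx Ny yxs; apply: contrapT => xy.
apply: (lin (-1) _ _ Nx Ny); rewrite scaleN1r addrC; split => //= yx.
by apply: xy; apply/esym/eqP; rewrite -subr_eq0 yx.
Qed.

(** If [N] were contained in the finite list [s], shrinking it by [nbhs0_separated] would isolate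
    0. *)
Lemma nbhs0_not_mem (s : seq V) N : hausdorff_space V ->
  ~ nbhs (0 : V) [set 0] -> nbhs (0 : V) N -> exists2 x, N x & x \notin s.
Proof.
move=> V_haus n0 N0; apply: contrapT => Ns; apply: n0.
have [M M0 sep] := nbhs0_separated s V_haus.
apply: filterS (filterI N0 M0) => x [Nx Mx]; apply/esym/sep => //.
  exact: nbhs_singleton M0.
by rewrite subr0; apply/negPn/negP => xs; apply: Ns; exists x.
Qed.

(** Continuity at 0 of the coordinate functionals, in a form that presupposes neither independence
    nor a basis: [N] depends on [i] but not on the length [m]. Independence follows because 0 lies
    in [N]. *)
Definition continuous_coordinates e := forall i, exists2 N,
  nbhs (0 : V) N &
  forall m (c : nat -> K), (i < m)%N -> N (\sum_(j < m) c j *: e j) -> c i = 0.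

(** * Construction of the sequence *)

Section Chain.
Variables (e : nat -> V) (t : nat -> seq V).
Hypothesis tS : forall n, t n.+1 = e n :: t n.

Lemma sum_mem_chain n (c : nat -> K) : \sum_(i < n) c i *: e i \in combos (t n).
Proof.
elim: n => [|n IHn]; first by rewrite big_ord0 combos0.
rewrite big_ord_recr /= tS; apply/mem_combos_cons.
by exists (c n), (\sum_(i < n) c i *: e i); rewrite // addrC.
Qed.

(** The vector of highest index heads the list and avoids the span of the earlier ones, so
    coefficients vanish from the top down. *)
Lemma chain_coef n (c : nat -> K) : lin_free (t n) ->
  \sum_(i < n) c i *: e i = 0 -> forall i, (i < n)%N -> c i = 0.
Proof.
elim: n => // n IHn; rewrite tS big_ord_recr /= => /andP[en tn] s0 i.
have cn : c n = 0.
  by apply: (lin_free_eq0 en (sum_mem_chain n c)); rewrite addrC.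
rewrite ltnS leq_eqVlt => /orP[/eqP->//|]; apply: IHn => //.
by move: s0; rewrite cn scale0r addr0.
Qed.

End Chain.

Lemma discrete_coordinates : infinite_dimensional [set: V] ->
  nbhs (0 : V) [set 0] -> exists e, continuous_coordinates e.
Proof.
move=> Vinf V0.
have step (a : {t : seq V | lin_free t}) :
    {b : {t : seq V | lin_free t} | exists x, sval b = x :: sval a}.
  apply: cid; case: a => t tfree.
  have [x xt] := lin_free_extend Vinf tfree.
  have xtfree : lin_free (x :: t) by rewrite /= xt.
  by exists (exist (fun t : seq V => lin_free t) _ xtfree), x.
have [a [_ aS]] :=
  dependent_choice step (exist (fun t : seq V => lin_free t) [::] isT).
have /choice[e eP] := aS.
(* With [N] equal to {0}, the condition is just linear independence. *)
exists e => i; exists [set 0] => // m c im s0.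
exact: (@chain_coef e (sval \o a) eP m c (svalP (a m)) s0 i im).
Qed.

Lemma nondiscrete_coordinates : hausdorff_space V ->
  ~ nbhs (0 : V) [set 0] -> exists e, continuous_coordinates e.
Proof.
move=> V_haus V0.
(* A state holds the vectors chosen so far and a neighbourhood whose differences meet their span
   only in 0. *)
pose good (a : seq V * set V) := [/\ lin_free a.1, nbhs (0 : V) a.2 &
  forall x y, a.2 x -> a.2 y -> y - x \in combos a.1 -> x = y].
pose next (a b : seq V * set V) (x : V) :=
  b.1 = x :: a.1 /\ exists2 M : set V, M x /\ b.2 `<=` M &
    forall (c : K) x y, M x -> M y -> a.2 (c *: x + y).
have step (a : {a | good a}) :
    {b : {b | good b} | exists x, next (sval a) (sval b) x}.
  apply: cid; case: a => -[t N] [/= tfree N0 sep].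
  have [M M0 lin] := nbhs0_linear N0.
  have [x Mx xt] := nbhs0_not_mem (combos t) V_haus V0 M0.
  have [L L0 sepL] := nbhs0_separated (combos (x :: t)) V_haus.
  have xtgood : good (x :: t, M `&` L).
    split=> /=; [by rewrite xt|exact: filterI|].
    by move=> y z [_ Ly] [_ Lz]; exact: sepL.
  by exists (exist good _ xtgood), x; split=> //; exists M => //; split=> // y [].
have good0 : good ([::], setT).
  split=> //=; first exact: filterT.
  by move=> x y _ _; rewrite inE subr_eq0 => /eqP->.
have [a [_ aS]] := dependent_choice step (exist good _ good0).
have /choice[e eP] := aS.
pose t n := (sval (a n)).1; pose N n := (sval (a n)).2.
have tS n : t n.+1 = e n :: t n by have [] := eP n.
have tfree n : lin_free (t n) by have [] := svalP (a n).
have N0 n : nbhs (0 : V) (N n) by have [] := svalP (a n).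
have sep n x y : N n x -> N n y -> y - x \in combos (t n) -> x = y.
  by have [_ _] := svalP (a n); apply.
(* Induction on the number of terms: the sum without its first term lies in [N n.+1], hence in [M]
   along with [e n], and [lin] puts the whole sum in [N n]. *)
have tail (c : nat -> K) k n : N n (\sum_(n <= j < n + k) c j *: e j).
  elim: k n => [|k IHk] n.
    by rewrite addn0 big_geq//; exact: nbhs_singleton (N0 n).
  rewrite -addSnnS big_ltn ?leq_addr//.
  have [_ [M [Mx NM] lin]] := eP n.
  by apply: lin => //; apply: NM; exact: IHk.
(* The index is [i.+1] because [t i.+1] is the first list containing [e i]. *)
exists e => i; exists (N i.+1) => // m c im Nc.
suff head0 : \sum_(j < i.+1) c j *: e j = 0.
  exact: (@chain_coef e t tS _ c (tfree i.+1) head0 i (ltnSn i)).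
have := tail c (m - i.+1)%N i.+1; rewrite subnKC// => Ntail.
have sumE : \sum_(j < m) c j *: e j =
    \sum_(j < i.+1) c j *: e j + \sum_(i.+1 <= j < m) c j *: e j.
  by rewrite -!(big_mkord xpredT (fun j => c j *: e j)) -big_cat_nat.
(* The full sum and its tail both lie in [N i.+1] and differ by the head, an element of
   [combos (t i.+1)]; separation makes them equal. *)
have yx : \sum_(i.+1 <= j < m) c j *: e j = \sum_(j < m) c j *: e j.
  by apply: (sep _ _ _ Ntail Nc);
    rewrite sumE addrK; exact: sum_mem_chain tS _ c.
apply/eqP; rewrite -(addrK (\sum_(i.+1 <= j < m) c j *: e j) (\sum_(j < _) _)).
by rewrite -sumE -yx subrr.
Qed.

(** * Coordinates on the span of the sequence *)

Section Span.
Variable e : nat -> V.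
Hypothesis ecoord : continuous_coordinates e.

Lemma coordinates_inj : injective e.
Proof.
move=> i j eij; apply/eqP/negPn/negP => ij.
pose m := (maxn i j).+1.
have delta k : (k < m)%N -> \sum_(l < m) (nat_of_ord l == k)%:R *: e l = e k.
  move=> km; rewrite (bigD1 (Ordinal km))//= eqxx scale1r big1 ?addr0// => l.
  by rewrite -val_eqE /= => /negPf ->; rewrite scale0r.
have im : (i < m)%N by rewrite ltnS leq_maxl.
have jm : (j < m)%N by rewrite ltnS leq_maxr.
have [N N0 coefN] := ecoord i.
(* If [e i = e j], the combination [e i - e j] is 0 and so lies in [N], although its coefficient at
   [i] is 1. *)
have : (i == i)%:R - (i == j)%:R = 0 :> K.
  apply: (coefN m (fun l => (l == i)%:R - (l == j)%:R) im).
  under eq_bigr do rewrite scalerBl.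
  by rewrite sumrB !delta// eij subrr; exact: nbhs_singleton N0.
by move=> /eqP; rewrite eqxx (negPf ij) subr0 oner_eq0.
Qed.

Lemma range_indep : lin_independent (range e).
Proof.
move=> s c us se s0 x xs; have [i _ eix] := se _ xs.
(* A strict bound on the indices of the vectors in [s]; the default 0 of [xget] never occurs, as
   each of them is some [e j]. *)
pose b := (\max_(y <- s) (xget 0 (e @^-1` [set y])).+1)%N.
pose r := [seq e j | j <- iota 0 b].
have ur : uniq r by rewrite map_inj_uniq ?iota_uniq//; exact: coordinates_inj.
have idx y j : y = e j -> xget 0%N (e @^-1` [set y]) = j.
  by move=> ->; apply: xget_unique => // k; exact: coordinates_inj.
have sr : {subset s <= r}.
  move=> y ys; have [j _ ejy] := se _ ys; rewrite -ejy map_f// mem_iota /=.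
  rewrite add0n; apply: leq_trans (leq_bigmax_seq _ ys isT).
  by rewrite (idx _ j).
have : x \in r by exact: sr.
rewrite -eix mem_map; last exact: coordinates_inj.
rewrite mem_iota /= add0n => im; have [N N0 coefN] := ecoord i.
have := coefN _ (fun j => c (e j) *+ count_mem (e j) s) im.
rewrite count_uniq_mem// eix xs; apply.
move: s0; rewrite (sum_count_mem _ ur sr) big_map -[b in iota 0 b]subn0.
rewrite -/(index_iota 0 b) big_mkord.
under eq_bigr do rewrite scalerMnl.
by move=> ->; exact: nbhs_singleton N0.
Qed.

Lemma range_basis : is_basis (lin_span (range e)) (range e).
Proof. by split=> //; exact: range_indep. Qed.

Definition range_elt i : range e := exist _ (e i) (mem_set (imageT e i)).

(** Every length from [m0] on is allowed so that two vectors of the span can be expanded over the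
    same initial segment and subtracted. *)
Lemma components_coef w : lin_span (range e) w ->
  exists m0 (a : nat -> K),
    (forall i, set_val (components (range e) w (range_elt i)) = a i *: e i) /\
    forall m, (m0 <= m)%N -> w = \sum_(i < m) a i *: e i.
Proof.
move=> /(componentsP range_basis); set c := components _ _ => -[fin_c wE].
have /choice[a aE] i : exists a : K, set_val (c (range_elt i)) = a *: e i.
  by have [a _ aE] := set_valP (c (range_elt i)); exists a; exact/esym.
have elt_inj : injective range_elt.
  by move=> i j /(congr1 set_val) /=; exact: coordinates_inj.
have /finite_seqP[s sE] : finite_set [set i | set_val (c (range_elt i)) != 0].
  apply: (finite_preimage _ fin_c (f := range_elt)) => i j _ _; exact: elt_inj.
exists (\max_(i <- s) i.+1), a; split=> // m sm.
have bij : set_bij [set: nat] [set: range e] range_elt.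
  split=> [//|i j _ _|x _]; first exact: elt_inj.
  by have [i _ eix] := set_valP x; exists i => //; exact/val_inj.
rewrite {1}wE (reindex_fsbig _ _ _ _ bij) (fsbig_ord _ _ (fun i => a i *: e i)).
rewrite -(fsbig_widen `I_m setT)//.
  by apply: eq_fsbigr => i _; exact: aE.
move=> i [_ /= im]; apply/eqP/negPn/negP => ci; apply: im.
have : [set` s] i by rewrite -sE.
by move=> /= si; apply: leq_trans sm; exact: (leq_bigmax_seq _ si isT).
Qed.

Let W := lin_span (range e).

(** The projection is locally constant: if [w' - w] lies in the neighbourhood [N] for index [i],
    then [w] and [w'] have the same coefficient at [e i]. *)
Lemma proj_line_continuous (x : range e) :
  continuous (proj_line W x : W -> discrete_topology (line (set_val x))).
Proof.
have [i _ eix] := set_valP x; have -> : x = range_elt i by exact/val_inj.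
move=> w; have Fw : Filter (nbhs (w : W)) by exact: nbhs_filter.
apply/discrete_cvg; have [N N0 coefN] := ecoord i.
have Nw : nbhs w [set w' : W | N (set_val w' - set_val w)].
  apply: (@initial_continuous _ V (set_val : W -> V) w
    [set v | N (v - set_val w)]).
  by apply: (addl_continuous (v := - set_val w)); rewrite /= subrr.
apply: filterS Nw => w' /= Nw'; apply/val_inj.
have [m [a [aE wE]]] := components_coef (set_valP w).
have [m' [a' [a'E w'E]]] := components_coef (set_valP w').
change (set_val (components (range e) (set_val w') (range_elt i)) =
        set_val (components (range e) (set_val w) (range_elt i))).
rewrite aE a'E; congr (_ *: _); apply/eqP; rewrite -subr_eq0; apply/eqP.
pose M := maxn i.+1 (maxn m m').
apply: (coefN M (fun j => a' j - a j)); first exact: leq_maxl.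
under eq_bigr do rewrite scalerBl.
by rewrite sumrB -wE -?w'E// /M !leq_max leqnn !orbT.
Qed.

Lemma to_lines_prod_continuous :
  continuous (@to_lines_prod K V W (range e) : W -> lines_prod (range e)).
Proof.
move=> w; have Fw : Filter (nbhs (w : W)) by exact: nbhs_filter.
(* The product topology is the supremum of those pulled back from the factors, so one coordinate at
   a time suffices. *)
apply/cvg_sup => x A /= [B [[C oC <-] Cw] CA].
have wC : nbhs (w : W) (proj_line W x @^-1` C).
  by apply: proj_line_continuous; exact: open_nbhs_nbhs.
change (nbhs (w : W) (@to_lines_prod K V W (range e) @^-1` A)).
by apply: filterS wC => w'; exact: CA.
Qed.

End Span.

End BasicSequence.

Theorem theorem2 (p : nat) (p_prime : prime p) (V : discTvsType 'F_p)
    (V_hausdorff : hausdorff_space V)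
    (V_inf : infinite_dimensional [set: V]) :
  exists W : set V,
    [/\ subvector_space W,
        infinite_dimensional W &
        exists E : set V,
          [/\ is_basis W E,
              forall U : set W, @open (basis_topology W E) U -> @open W U &
              forall e : E,
                continuous (proj_line W e
                  : W -> discrete_topology (line (set_val e)))]].
Proof.
have [e ecoord] : exists e : nat -> V, continuous_coordinates e.
  have [V0|V0] := pselect (nbhs (0 : V) [set 0]).
    exact: discrete_coordinates.
  exact: nondiscrete_coordinates.
exists (lin_span (range e)); split; first exact: subvector_space_lin_span.
  apply: (infinite_dimensional_injective (coordinates_inj ecoord)) => n.
  exists [:: e n], (fun=> 1); rewrite big_seq1 scale1r; split=> // x.
  by rewrite /= inE => /eqP ->; exists n.
exists (range e); split; [exact: range_basis| |exact: proj_line_continuous].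
(* An open set of the initial topology is the preimage of an open set [A] of the product. *)
move=> _ [A oA <-]; move/continuousP: (to_lines_prod_continuous ecoord); exact.
Qed.
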